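(* Let $\mathcal{G}$ be a Fréchet Lie group, let $\mathcal{P}$ be a Fréchet principal $\mathcal{G}$-bundle over a Fréchet manifold $\mathcal{M}$, and consider a smooth representation of $\mathcal{G}$ on a rigged $C^*$-algebra $A$. Then the associated bundle $(\mathcal{P}\times A)/\mathcal{G}$, with the norm $\|[p,a]\|:=\|a\|$, the multiplication $[p,a_1][p,a_2]:=[p,a_1a_2]$ and the involution $[p,a]^*:=[p,a^*]$, is a rigged $C^*$-algebra bundle over $\mathcal{M}$ with fibre $A$.
   Context: A rigged $C^*$-algebra is a Fréchet algebra $A$ (Fréchet space with continuous algebra multiplication), equipped with a continuous norm and a continuous complex anti-linear involution such that its norm completion is a $C^*$-algebra. A morphism is a continuous algebra homomorphism, bounded for the norms, intertwining the involutions; isometric if norm-preserving. A smooth representation of $\mathcal{G}$ on $A$ is an action by isometric morphisms of rigged $C^*$-algebras such that $\mathcal{G}\times A\to A$ is smooth. A rigged $C^*$-algebra bundle over $\mathcal{M}$ with fibre $A$ is a Fréchet vector bundle $\mathcal{A}\to\mathcal{M}$ equipped with a map $\|\cdot\|:\mathcal{A}\to\mathbb{R}_{\ge0}$, a fibre-preserving map $m:\mathcal{A}\times_{\mathcal{M}}\mathcal{A}\to\mathcal{A}$ and a fibre-preserving map $*:\mathcal{A}\to\mathcal{A}$, such that for each $x\in\mathcal{M}$: $\|\cdot\|_x$ is a norm; $m_x$ turns $\mathcal{A}_x$ into an associative algebra; $*_x$ turns it into a $*$-algebra; and there is an open neighbourhood $U$ of $x$ and a diffeomorphism $\mathcal{A}|_U\to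 U\times A$ which is fibrewise an isometric isomorphism of $*$-algebras. In $(\mathcal{P}\times A)/\mathcal{G}$, the group acts by $(p,a)g=(pg,g^{-1}a)$; the quotient carries the unique Fréchet manifold structure for which the projection from $\mathcal{P}\times A$ is a surjective submersion, and the evident fibrewise vector space structure. *)

(* Defs.v *)
From HB Require Import structures.
From mathcomp Require Import all_boot all_order all_algebra.
From mathcomp Require Import all_classical all_reals all_analysis.
From mathcomp Require Import complex generic_quotient.

Set Implicit Arguments.
Unset Strict Implicit.
Unset Printing Implicit Defensive.

Import Order.TTheory GRing.Theory Num.Theory.
Import numFieldNormedType.Exports.
Local Open Scope classical_set_scope.
Local Open Scope ring_scope.
Local Open Scope complex_scope.

(* Completeness is expressed with Cauchy sequences for the additive structure: the
   uniformity carried by a tvsType is not required to be translation invariant.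
   A Hausdorff topological vector space with a countable base of neighbourhoods
   of 0 is metrizable, so sequences suffice. *)
Record is_frechet (K : numDomainType) (E : tvsType K) : Prop := {
  frechet_hausdorff : hausdorff_space E;
  frechet_countable : exists B : nat -> set E,
    (forall n, nbhs 0 (B n)) /\
    (forall U : set E, nbhs 0 U -> exists n, B n `<=` U);
  frechet_complete : forall u : nat -> E,
    (forall U : set E, nbhs 0 U ->
       exists N, forall m n, (N <= m)%N -> (N <= n)%N -> U (u m - u n)) ->
    exists l : E, u @ \oo --> l }.

(* The real locally convex space underlying a complex one. *)
Definition realify (R : realType) (V : tvsType R[i]) : Type := V.

Section Realify.
Variables (R : realType) (V : tvsType R[i]).
Local Notation W := (realify V).

HB.instance Definition _ := TopologicalZmodule.on W.
HB.instance Definition _ := Uniform.on W.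

Definition realify_scale (t : R) (v : W) : W := (t%:C *: (v : V) : V).

Fact realify_scaleA a b v :
  realify_scale a (realify_scale b v) = realify_scale (a * b) v.
Proof. by rewrite /realify_scale scalerA -rmorphM. Qed.
Fact realify_scale1 : left_id 1 realify_scale.
Proof. by move=> v; rewrite /realify_scale rmorph1 scale1r. Qed.
Fact realify_scaleDr : right_distributive realify_scale +%R.
Proof. by move=> a u v; rewrite /realify_scale scalerDr. Qed.
Fact realify_scaleDl v : {morph realify_scale^~ v : a b / a + b}.
Proof. by move=> a b; rewrite /realify_scale rmorphD scalerDl. Qed.

HB.instance Definition _ := GRing.Zmodule_isLmodule.Build R W
  realify_scaleA realify_scale1 realify_scaleDr realify_scaleDl.

Fact realify_scale_continuous : continuous (fun z : R^o * W => z.1 *: z.2).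
Proof.
have Cc : continuous ((real_complex R) : R^o -> R[i]^o).
  move=> t; apply/cvgrPdist_lt => e e0.
  have eE : e = (complex.Re e)%:C.
    by case: e e0 => a b; rewrite ltcE /= => /andP[/eqP ->].
  have r0 : 0 < complex.Re e by rewrite -ltcR -eE.
  near=> s; rewrite -rmorphB normc_def /= expr0n addr0 sqrtr_sqr eE ltcR.
  by near: s; exact: cvgr_dist_lt.
move=> [t v]; apply: (@continuous_comp _ _ _
  (fun z : R^o * W => ((z.1%:C : R[i]^o), (z.2 : V)))
  (fun z : R[i]^o * V => z.1 *: z.2)); last exact: scale_continuous.
have h1 : (z.1%:C : R[i]^o) @[z --> ((t, v) : R^o * W)] --> (t%:C : R[i]^o).
  by apply: (cvg_comp (@fst R^o W) (real_complex R)); [exact: cvg_fst | exact: Cc].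
have h2 : (z.2 : V) @[z --> ((t, v) : R^o * W)] --> (v : V) by exact: cvg_snd.
exact: (cvg_pair h1 h2).
Unshelve. all: by end_near. Qed.
Fact realify_locally_convex : exists2 B : set_system W,
    (forall b, b \in B -> convex_set b) & basis B.
Proof.
have [B cB bB] := @locally_convex _ V; exists B => // b /cB cb x y l xb yb.
have l0 : 0 <= l%:num%:C :> R[i] by rewrite ler0c.
have l1 : l%:num%:C <= 1 :> R[i] by rewrite -(rmorph1 (real_complex R)) lecR.
have := cb x y (Itv01 l0 l1) xb yb.
congr (_ \in b).
change (l%:num%:C *: (x : V) + (1 - l%:num%:C) *: (y : V) =
  l%:num%:C *: (x : V) + (1 - l%:num)%:C *: (y : V)).
by rewrite rmorphB (rmorph1 (real_complex R)).
Qed.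

HB.instance Definition _ := TopologicalNmodule_isTopologicalLmodule.Build R W
  realify_scale_continuous.
HB.instance Definition _ := Uniform_isTvs.Build R W realify_locally_convex.
End Realify.

(* Michal-Bastiani (Hamilton) calculus: f is C^(n+1) on the open set U when its
   directional derivative df : U * E -> F exists and is C^n.  The values of f
   outside U are irrelevant. *)
Fixpoint Ck (R : realType) (n : nat) (E F : tvsType R) (U : set E) (f : E -> F)
    : Prop :=
  (forall x, U x -> {for x, continuous f}) /\
  if n is m.+1 then
    exists df : E * E -> F,
      (forall x v, U x ->
         h^-1 *: (f (h *: v + x) - f x) @[h --> (0 : R)^'] --> df (x, v)) /\
      Ck m (U `*` setT) df
  else True.

Definition Cinf (R : realType) (E F : tvsType R) (U : set E) (f : E -> F) :=
  forall n, Ck n U f.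

(* A local chart is given by total functions c_map and c_inv, meaningful on
   c_dom and c_cod only. *)
Record chart (R : realType) (M : topologicalType) (E : tvsType R) := Chart {
  c_dom : set M;
  c_cod : set E;
  c_map : M -> E;
  c_inv : E -> M }.

Record is_chart (R : realType) (M : topologicalType) (E : tvsType R)
    (c : chart M E) : Prop := {
  chart_model : is_frechet E;
  chart_dom : open (c_dom c);
  chart_cod : open (c_cod c);
  chart_mapK : forall x, c_dom c x -> c_cod c (c_map c x) /\ c_inv c (c_map c x) = x;
  chart_invK : forall y, c_cod c y -> c_dom c (c_inv c y) /\ c_map c (c_inv c y) = y;
  chart_map_cont : forall x, c_dom c x -> {for x, continuous (c_map c)};
  chart_inv_cont : forall y, c_cod c y -> {for y, continuous (c_inv c)} }.

Definition transition_smooth (R : realType) (M : topologicalType)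
    (E F : tvsType R) (c : chart M E) (d : chart M F) :=
  Cinf (c_cod c `&` c_inv c @^-1` c_dom d) (c_map d \o c_inv c).

(* A space with a collection of charts; the axioms of an atlas are stated
   separately, in is_frechet_manifold, so that products can be formed freely. *)
Definition atlas (R : realType) (M : topologicalType) :=
  forall E : tvsType R, set (chart M E).

Record atlasSpace (R : realType) := AtlasSpace {
  as_sort :> topologicalType;
  as_atlas : atlas R as_sort }.

Record is_frechet_manifold (R : realType) (M : atlasSpace R) : Prop := {
  manifold_hausdorff : hausdorff_space M;
  manifold_chart : forall E (c : chart M E), as_atlas c -> is_chart c;
  manifold_cover : forall x : M, exists E (c : chart M E), as_atlas c /\ c_dom c x;
  manifold_compat : forall E F (c : chart M E) (d : chart M F),
    as_atlas c -> as_atlas d -> transition_smooth c d }.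

Record frechetManifold (R : realType) := FrechetManifold {
  fm_space :> atlasSpace R;
  fmP : is_frechet_manifold fm_space }.

(* c belongs to the maximal atlas of M. *)
Definition smooth_chart (R : realType) (M : atlasSpace R) (E : tvsType R)
    (c : chart M E) :=
  is_chart c /\
  forall F (d : chart M F), as_atlas d ->
    transition_smooth c d /\ transition_smooth d c.

Variant tvs_atlas (R : realType) (E : tvsType R) :
    forall F : tvsType R, chart E F -> Prop :=
  | TvsChart : tvs_atlas (Chart setT setT id id : chart E E).

Definition tvs_space (R : realType) (E : tvsType R) : atlasSpace R :=
  AtlasSpace (@tvs_atlas R E).

Definition prod_chart (R : realType) (M N : topologicalType) (E F : tvsType R)
    (c : chart M E) (d : chart N F) : chart (M * N)%type (E * F)%type :=
  Chart (c_dom c `*` c_dom d) (c_cod c `*` c_cod d)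
    (fun z => (c_map c z.1, c_map d z.2)) (fun z => (c_inv c z.1, c_inv d z.2)).

Variant prod_atlas (R : realType) (M N : atlasSpace R) :
    forall G : tvsType R, chart (M * N)%type G -> Prop :=
  | ProdChart (E F : tvsType R) (c : chart M E) (d : chart N F) :
      as_atlas c -> as_atlas d -> prod_atlas (prod_chart c d).

Definition prod_space (R : realType) (M N : atlasSpace R) : atlasSpace R :=
  AtlasSpace (@prod_atlas R M N).

Definition smooth_on (R : realType) (M N : atlasSpace R) (D : set M)
    (f : M -> N) :=
  (forall x, D x -> {for x, continuous f}) /\
  forall E F (c : chart M E) (d : chart N F), as_atlas c -> as_atlas d ->
    Cinf (c_cod c `&` c_inv c @^-1` (D `&` f @^-1` c_dom d))
      (c_map d \o f \o c_inv c).

Definition smooth (R : realType) (M N : atlasSpace R) (f : M -> N) :=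
  smooth_on setT f.

(* f restricts to a diffeomorphism from the open set D onto the open set D'. *)
Definition diffeo_on (R : realType) (M N : atlasSpace R) (f : M -> N)
    (D : set M) (D' : set N) :=
  [/\ open D, open D', smooth_on D f &
   exists g : N -> M, [/\ smooth_on D' g,
     forall x, D x -> D' (f x) /\ g (f x) = x &
     forall y, D' y -> D (g y) /\ f (g y) = y]].

(* Around every point there are charts in which f is the projection of a
   product onto its first factor. *)
Definition submersion (R : realType) (M N : atlasSpace R) (f : M -> N) :=
  smooth f /\
  forall x, exists (E F : tvsType R) (c : chart M (E * F)%type) (d : chart N E),
    [/\ smooth_chart c, smooth_chart d, c_dom c x &
        forall y, c_dom c y -> c_dom d (f y) /\ c_map d (f y) = (c_map c y).1].

#[short(type="topGroupType")]
HB.structure Definition TopGroup := {G of Topological G & Group G}.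

Record frechetLieGroup (R : realType) := FrechetLieGroup {
  lg_sort :> topGroupType;
  lg_atlas : atlas R lg_sort;
  lg_space := AtlasSpace lg_atlas;
  lg_manifold : is_frechet_manifold lg_space;
  lg_mul_smooth : smooth (M := prod_space lg_space lg_space) (N := lg_space)
    (fun z => (z.1 * z.2)%g);
  lg_inv_smooth : smooth (M := lg_space) (N := lg_space) (fun g => g^-1%g) }.

Record principalBundle (R : realType) (G : frechetLieGroup R)
    (M : frechetManifold R) := PrincipalBundle {
  pb_total :> frechetManifold R;
  pb_proj : pb_total -> M;
  pb_act : pb_total -> G -> pb_total;
  pb_proj_smooth : smooth pb_proj;
  pb_act_smooth : smooth (M := prod_space pb_total (lg_space G)) (N := pb_total)
    (fun z => pb_act z.1 z.2);
  pb_act1 : forall p, pb_act p 1%g = p;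
  pb_actM : forall p g h, pb_act p (g * h)%g = pb_act (pb_act p g) h;
  pb_proj_act : forall p g, pb_proj (pb_act p g) = pb_proj p;
  pb_triv : forall x : M, exists (U : set M)
      (phi : pb_total -> prod_space M (lg_space G)),
    [/\ open U, U x,
        diffeo_on phi (pb_proj @^-1` U) (U `*` setT),
        forall p, U (pb_proj p) -> (phi p).1 = pb_proj p &
        forall p g, U (pb_proj p) -> (phi (pb_act p g)).2 = ((phi p).2 * g)%g] }.

(* Not necessarily unital, hence not an instance of the library's algebras. *)
Record is_star_algebra (R : realType) (V : lmodType R[i]) (mul : V -> V -> V)
    (star : V -> V) : Prop := {
  star_algebra_mulA : associative mul;
  star_algebra_mul_linearl : forall b, linear (mul ^~ b);
  star_algebra_mul_linearr : forall a, linear (mul a);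
  star_algebra_star_antilinear : forall (k : R[i]) a b,
    star (k *: a + b) = conjc k *: star a + star b;
  star_algebra_starK : involutive star;
  star_algebra_starM : forall a b, star (mul a b) = mul (star b) (star a) }.

Record is_norm (R : realType) (V : lmodType R[i]) (N : V -> R) : Prop := {
  is_norm_ge0 : forall v, 0 <= N v;
  is_norm_eq0 : forall v, N v = 0 -> v = 0;
  is_normZ : forall (k : R[i]) v, (N (k *: v))%:C = `|k| * (N v)%:C;
  is_normD : forall u v, N (u + v) <= N u + N v }.

(* The norm `|a| of a complex normed module takes its values in R[i]. *)
Record cstarAlgebra (R : realType) := CstarAlgebra {
  cs_sort :> completeNormedModType R[i];
  cs_mul : cs_sort -> cs_sort -> cs_sort;
  cs_star : cs_sort -> cs_sort;
  cs_algebra : is_star_algebra cs_mul cs_star;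
  cs_normM : forall a b, `|cs_mul a b| <= `|a| * `|b|;
  cs_cstar : forall a, `|cs_mul (cs_star a) a| = `|a| ^+ 2 }.

(* The norm completion of (V, N) is a C*-algebra B: j is the isometric dense
   embedding of V into B, along which the operations of B extend those of V. *)
Definition completes_to_cstar (R : realType) (V : lmodType R[i])
    (mul : V -> V -> V) (star : V -> V) (N : V -> R) :=
  exists (B : cstarAlgebra R) (j : V -> B),
    [/\ linear j,
        forall a, `|j a| = (N a)%:C,
        dense (range j),
        forall a b, j (mul a b) = cs_mul (j a) (j b) &
        forall a, j (star a) = cs_star (j a)].

Record riggedCstar (R : realType) := RiggedCstar {
  rc_sort :> tvsType R[i];
  rc_mul : rc_sort -> rc_sort -> rc_sort;
  rc_star : rc_sort -> rc_sort;
  rc_norm : rc_sort -> R;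
  rc_frechet : is_frechet rc_sort;
  rc_algebra : is_star_algebra rc_mul rc_star;
  rc_is_norm : is_norm rc_norm;
  rc_mul_cont : continuous (fun z : rc_sort * rc_sort => rc_mul z.1 z.2);
  rc_star_cont : continuous rc_star;
  rc_norm_cont : continuous rc_norm;
  rc_completion : completes_to_cstar rc_mul rc_star rc_norm }.

(* As a manifold, A is the real Frechet space underlying it. *)
Definition rc_space (R : realType) (A : riggedCstar R) : atlasSpace R :=
  tvs_space (realify A).

Record is_rigged_morphism (R : realType) (A B : riggedCstar R) (f : A -> B)
    : Prop := {
  rigged_morphism_linear : linear f;
  rigged_morphism_cont : continuous f;
  rigged_morphism_mul : forall a b, f (rc_mul a b) = rc_mul (f a) (f b);
  rigged_morphism_star : forall a, f (rc_star a) = rc_star (f a);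
  rigged_morphism_bounded : exists C : R, forall a, rc_norm (f a) <= C * rc_norm a }.

Definition isometric (R : realType) (A B : riggedCstar R) (f : A -> B) :=
  forall a, rc_norm (f a) = rc_norm a.

Record smoothRep (R : realType) (G : frechetLieGroup R) (A : riggedCstar R) :=
    SmoothRep {
  rep :> G -> A -> A;
  rep1 : forall a, rep 1%g a = a;
  repM : forall g h a, rep (g * h)%g a = rep g (rep h a);
  rep_morphism : forall g, is_rigged_morphism (rep g);
  rep_isometric : forall g, isometric (rep g);
  rep_smooth : smooth (M := prod_space (lg_space G) (rc_space A))
    (N := rc_space A) (fun z => rep z.1 z.2) }.

Definition fibre (E : Type) (M : eqType) (pi : E -> M) (x : M) :=
  {e : E | pi e == x}.

Definition fibre_lmod (R : realType) (E : Type) (M : eqType) (pi : E -> M) :=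
  forall x, GRing.Lmodule R[i] (fibre pi x).

Definition fib (R : realType) (E : Type) (M : eqType) (pi : E -> M)
    (L : fibre_lmod R pi) (x : M) : lmodType R[i] := GRing.Lmodule.Pack (L x).

Definition fib_val (R : realType) (E : Type) (M : eqType) (pi : E -> M)
    (L : fibre_lmod R pi) (x : M) (u : fib L x) : E := sval (u : fibre pi x).

Definition vb_trivialisation (R : realType) (E M : atlasSpace R) (pi : E -> M)
    (L : fibre_lmod R pi) (F : tvsType R[i]) (U : set M)
    (phi : E -> prod_space M (tvs_space (realify F))) :=
  [/\ open U,
      diffeo_on phi (pi @^-1` U) (U `*` setT),
      forall e, U (pi e) -> (phi e).1 = pi e &
      forall x, U x -> linear (fun u : fib L x => (phi (fib_val u)).2 : F)].

Definition is_frechet_vector_bundle (R : realType) (E M : atlasSpace R)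
    (pi : E -> M) (L : fibre_lmod R pi) (F : tvsType R[i]) :=
  [/\ is_frechet_manifold E, is_frechet_manifold M, is_frechet F, smooth pi &
      forall x, exists U (phi : E -> prod_space M (tvs_space (realify F))),
        U x /\ vb_trivialisation L U phi].

(* A fibre-preserving map on the fibre product of E with itself is a family of
   binary operations on the fibres. *)
Record is_rigged_cstar_bundle (R : realType) (E M : atlasSpace R) (pi : E -> M)
    (L : fibre_lmod R pi) (N : E -> R)
    (mul : forall x, fib L x -> fib L x -> fib L x)
    (star : forall x, fib L x -> fib L x) (A : riggedCstar R) : Prop := {
  rcb_vector_bundle : is_frechet_vector_bundle L A;
  rcb_norm : forall x, is_norm (fun u : fib L x => N (fib_val u));
  rcb_star_algebra : forall x, is_star_algebra (@mul x) (@star x);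
  rcb_triv : forall x, exists U (phi : E -> prod_space M (rc_space A)),
    [/\ U x, vb_trivialisation (F := A) L U phi &
     forall y, U y ->
       let phi_y (u : fib L y) : A := (phi (fib_val u)).2 in
       [/\ forall u v, phi_y (mul y u v) = rc_mul (phi_y u) (phi_y v),
           forall u, phi_y (star y u) = rc_star (phi_y u) &
           forall u, rc_norm (phi_y u) = N (fib_val u)]] }.

Section Associated.
Local Open Scope quotient_scope.
Variables (R : realType) (G : frechetLieGroup R) (M : frechetManifold R).
Variables (P : principalBundle G M) (A : riggedCstar R) (rho : smoothRep G A).

Definition assoc_pair : atlasSpace R := prod_space P (rc_space A).

Definition assoc_rel : rel assoc_pair := fun z w =>
  `[< exists g : G, w = (pb_act z.1 g, rho g^-1%g z.2) >].

Fact assoc_rel_equiv : equiv_class_of assoc_rel.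
Proof.
split.
- by move=> [p a]; apply/asboolP; exists 1%g; rewrite pb_act1 invg1 rep1.
- suff sym z w : assoc_rel z w -> assoc_rel w z by move=> z w; apply/idP/idP => /sym.
  case: z w => [p a] [q b] /asboolP[g [-> ->]]; apply/asboolP; exists g^-1%g => /=.
  by rewrite -pb_actM mulgV pb_act1 invgK -repM mulgV rep1.
- move=> [q b] [p a] [r c] /asboolP[g [-> ->]] /asboolP[h [-> ->]].
  by apply/asboolP; exists (g * h)%g; rewrite /= pb_actM invgM repM.
Qed.

Definition assoc_equiv := EquivRelPack assoc_rel_equiv.

(* The orbit space (P * A) / G with the quotient topology; this is the topology
   of any manifold structure for which the projection is a surjective submersion,
   submersions being open maps. *)
Definition assoc_total : topologicalType :=
  quotient_topology {eq_quot assoc_equiv}.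

Definition assoc_class (z : assoc_pair) : assoc_total :=
  \pi_(quotient_topology {eq_quot assoc_equiv}) z.

Definition assoc_proj (e : assoc_total) : M :=
  pb_proj (repr (e : quotient_topology {eq_quot assoc_equiv})).1.

Fact assoc_projE p a : assoc_proj (assoc_class (p, a)) == pb_proj p.
Proof.
rewrite /assoc_proj /assoc_class.
case: piP => -[q b] /eqmodP /asboolP [g [-> _]] /=.
by rewrite pb_proj_act.
Qed.

Definition assoc_elt (p : P) (a : A) : fibre assoc_proj (pb_proj p) :=
  exist _ (assoc_class (p, a)) (assoc_projE p a).

End Associated.

Arguments assoc_pair {R G M} P A.
Arguments assoc_total {R G M} P {A} rho.
Arguments assoc_class {R G M P A} rho z.
Arguments assoc_proj {R G M P A} rho e.
Arguments assoc_elt {R G M P A} rho p a.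

(* Main.v *)
Require Import Defs.
From HB Require Import structures.
From mathcomp Require Import all_boot all_order all_algebra.
From mathcomp Require Import all_classical all_reals all_analysis.
From mathcomp Require Import complex generic_quotient.
From mathcomp Require Import ring lra.

Set Implicit Arguments.
Unset Strict Implicit.
Unset Printing Implicit Defensive.

Import Order.TTheory GRing.Theory Num.Theory.
Import numFieldNormedType.Exports.
Local Open Scope classical_set_scope.
Local Open Scope ring_scope.

(** Let pi : P -> M be the projection of the principal bundle and q the
    projection of P * A onto the associated bundle E.  By freeness of the
    action, a -> [p, a] is injective, and by transitivity on the fibres of pi
    it is onto the fibre of E over pi p; another choice of p changes this
    bijection by some rho g, which is linear, multiplicative, *-preserving and
    isometric.  So the whole structure of A is carried to each fibre of E,
    independently of p ([fib_coord], [fib_coord_elt]).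

    A local trivialisation p -> (pi p, phi2 p) of P, equivariant in its second
    component, gives [p, a] -> (pi p, rho (phi2 p) a) on E, with inverse
    (x, a) -> [s x, a] where s is the local section of P with phi2 (s x) = 1.
    It is fibrewise an isometric isomorphism of *-algebras because every rho g
    is one.  The inverse is smooth as a composite of smooth maps; the map itself
    is smooth because its composite with q is, and because a function on the
    base of a surjective submersion is smooth as soon as its pullback is
    ([submersion_descent]): submersions have smooth local sections.

    What remains is the calculus that makes composites of smooth maps smooth.
    Its core is the chain rule in locally convex spaces ([Ck_comp]).  The
    differential of g composed with f at (x, v) must be dg (f x, df (x, v)),
    while the difference quotients of f in the direction v only tend to
    df (x, v): one needs the difference quotients of g to converge when the
    direction varies too ([cvg_difference_quotient]).  A mean value theorem for
    convex sets ([mean_value]) gives this from the joint continuity of dg. *)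

(** * A mean value theorem for convex sets *)

Section MeanValue.
Variables (R : realType) (F : lmodType R).
Implicit Types (K : set F) (f : R -> F).

Definition slope f (s t : R) : F := (t - s)^-1 *: (f t - f s).

Lemma slopeC f s t : slope f s t = slope f t s.
Proof.
by rewrite /slope -opprB -[f t - _]opprB invrN scalerN scaleNr opprK.
Qed.

(** The slope over the union of two adjacent intervals is an average of their
    slopes, weighted by length. *)
Lemma slope_trans K f a t s : convex_set K -> a < t -> t < s ->
  K (slope f a t) -> K (slope f t s) -> K (slope f a s).
Proof.
move=> cK at_ ts K1 K2.
have a_s : 0 < s - a by lra.
have l0 : 0 <= (t - a) / (s - a) by apply: divr_ge0; lra.
have l1 : (t - a) / (s - a) <= 1 by rewrite ler_pdivrMr //; lra.
have := cK (slope f a t) (slope f t s) (Itv01 l0 l1).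
rewrite !inE => /(_ K1 K2); congr (K _).
change ((t - a) / (s - a) *: slope f a t +
  (1 - (t - a) / (s - a)) *: slope f t s = slope f a s).
rewrite /slope !scalerA.
have -> : (t - a) / (s - a) / (t - a) = (s - a)^-1.
  by field; rewrite !subr_eq0 !gt_eqF //; lra.
have -> : (1 - (t - a) / (s - a)) / (s - t) = (s - a)^-1.
  by field; rewrite !subr_eq0 !gt_eqF //; lra.
by rewrite -scalerDr [_ - _ + _]addrC addrA subrK.
Qed.

(** Let s be the supremum of the t for which the slope from a to t lies in K.
    As K is convex, slopes may be chained: those near s show first that s
    itself is such a t, then, if s < b, that a later point is one too. *)
Lemma mean_value K f a b : convex_set K -> a < b ->
  (forall t, a <= t <= b -> exists2 d, 0 < d &
     forall s, s != t -> `|s - t| < d -> K (slope f t s)) ->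
  K (slope f a b).
Proof.
move=> cK ab loc.
pose S : set R := [set t | a < t <= b /\ K (slope f a t)].
(* A good point before b is followed by a strictly later good point. *)
have stepS t d : (t = a \/ S t) -> t < b -> 0 < d ->
    (forall s, s != t -> `|s - t| < d -> K (slope f t s)) ->
    exists2 s, S s & t < s.
  move=> tS tb d0 near_t; pose s := Num.min b (t + d / 2).
  have ts : t < s by rewrite lt_min tb; lra.
  have sb : s <= b by rewrite ge_min lexx.
  have Kts : K (slope f t s).
    apply: near_t; first by rewrite gt_eqF.
    rewrite ger0_norm; last lra.
    by have : s <= t + d / 2 by [rewrite ge_min lexx orbT]; lra.
  exists s => //; case: tS => [ta|[/andP[at_ _] Kat]].
    by subst t; split; rewrite ?ts.
  by split; [rewrite sb (lt_trans at_ ts) | exact: slope_trans Kts].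
have [d d0 near_a] := loc a ltac:(by rewrite lexx ltW).
have [t0 St0 at0] := stepS a d (or_introl erefl) ab d0 near_a.
have supS : has_sup S by split; [exists t0 | exists b => t [/andP[]]].
pose s := sup S.
have as_ : a < s by apply: (lt_le_trans at0); exact: sup_upper_bound.
have sb : s <= b by apply: sup_le_ub; [exists t0 | move=> t [/andP[]]].
have [e e0 near_s] := loc s ltac:(by rewrite ltW).
have Ss : S s.
  have [t St st] := sup_adherent e0 supS.
  have ts : t <= s by exact: sup_upper_bound.
  move: ts; rewrite le_eqVlt => /predU1P[<- //|ts].
  have [/andP[at_ _] Kat] := St.
  split; first by rewrite as_.
  apply: (slope_trans cK at_ ts Kat); rewrite slopeC; apply: near_s.
    by rewrite lt_eqF.
  by rewrite ltr0_norm; rewrite -/s in st; lra.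
move: sb; rewrite le_eqVlt => /predU1P[sb|sb].
  by rewrite -sb; case: Ss.
have [s' Ss' ss'] := stepS s e (or_intror Ss) sb e0 near_s.
by have := sup_upper_bound supS Ss'; rewrite -/s; lra.
Qed.

End MeanValue.

(** * Differential calculus in locally convex spaces *)

Section TvsLimits.
Variables (R : realType).

Lemma line_continuous (E : tvsType R) (x : E) :
  continuous (fun z : R^o * E => z.1 *: z.2 + x).
Proof.
move=> z; apply: (@continuous2_cvg _ E E E _ _ (fun z : R^o * E => z.1 *: z.2)
  (fun=> x) +%R).
- exact: (@add_continuous E (z.1 *: z.2, x)).
- exact: scale_continuous.
- exact: cvg_cst.
Qed.

Lemma line_cvg (E : tvsType R) (x v : E) :
  h *: v + x @[h --> (0 : R)] --> x.
Proof.
have := @line_continuous E x (0, v); rewrite /continuous_at scale0r add0r.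
apply: cvg_trans.
have : (h : R^o, v) @[h --> (0 : R^o)] --> ((0, v) : R^o * E).
  by apply: (@cvg_pair _ _ _ (nbhs (0 : R^o)) (nbhs (0 : R^o)) (nbhs v));
    [exact: cvg_id | exact: cvg_cst].
by move=> c; exact: (cvg_comp _ (fun z : R^o * E => z.1 *: z.2 + x) c).
Qed.

Lemma near_line (E : tvsType R) (U : set E) (x v : E) :
  open U -> U x -> \forall h \near (0 : R)^', U (h *: v + x).
Proof.
move=> oU Ux.
have := @line_cvg E x v U (open_nbhs_nbhs (conj oU Ux)).
exact: nbhs_dnbhs.
Qed.

Lemma near0_ball (P : set R) : nbhs (0 : R) P ->
  exists2 d, 0 < d & forall h, `|h| < d -> P h.
Proof.
move=> /nbhs_ballP[d /= d0 dP]; exists d => // h hd; apply: dP.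
by rewrite /ball /= sub0r normrN.
Qed.

Lemma dnear0_ball (P : set R) : (\forall h \near (0 : R)^', P h) ->
  exists2 d, 0 < d & forall h, h != 0 -> `|h| < d -> P h.
Proof. by move=> /near0_ball[d d0 dP]; exists d => // h h0 /dP; apply. Qed.

(** The only way in which local convexity enters the calculus. *)
Lemma convex_nbhs (E : tvsType R) (x : E) (U : set E) : nbhs x U ->
  exists K : set E, [/\ open K, convex_set K, K x & K `<=` U].
Proof.
have [B cB [oB bB]] := @locally_convex _ E.
move=> /(bB x)[K [BK Kx] KU]; exists K; split => //; first exact: oB.
by apply: cB; rewrite inE.
Qed.

End TvsLimits.

Section CkBasics.
Variable R : realType.

Lemma Ck_continuous n (E F : tvsType R) (U : set E) (f : E -> F) :
  Ck n U f -> forall x, U x -> {for x, continuous f}.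
Proof. by case: n => [|n] []. Qed.

Lemma Ck_subset n (E F : tvsType R) (U V : set E) (f : E -> F) :
  V `<=` U -> Ck n U f -> Ck n V f.
Proof.
elim: n E F U V f => [|n IH] E F U V f VU [cf df]; split=> //;
  try by move=> x /VU /cf.
case: df => df [fdf Cdf]; exists df; split; first
  by move=> x v /VU; exact: fdf.
by apply: IH Cdf => -[x v] [/= /VU ? _]; split.
Qed.

Lemma eq_Ck n (E F : tvsType R) (U : set E) (f g : E -> F) :
  open U -> (forall x, U x -> f x = g x) -> Ck n U f -> Ck n U g.
Proof.
move=> oU fg Cf; have cf := Ck_continuous Cf.
have cg x : U x -> {for x, continuous g}.
  move=> Ux; change (g @ nbhs x --> g x); rewrite -(fg x Ux).
  apply: cvg_trans (cf x Ux); apply: near_eq_cvg.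
  by near=> y; apply: fg; near: y; exact: open_nbhs_nbhs.
case: n Cf => [|n] [_ df]; split => //.
case: df => df [fdf Cdf]; exists df; split => // x v Ux.
apply: cvg_trans (fdf x v Ux); apply: near_eq_cvg.
near=> h; have Uh : U (h *: v + x) by near: h; exact: near_line.
by rewrite /= !fg.
Unshelve. all: by end_near. Qed.

Lemma CkW n (E F : tvsType R) (U : set E) (f : E -> F) :
  Ck n.+1 U f -> Ck n U f.
Proof.
elim: n E F U f => [|n IH] E F U f [cf [df [fdf Cdf]]]; split => //.
by exists df; split => //; exact: IH.
Qed.

Lemma openX (E F : topologicalType) (U : set E) (V : set F) :
  open U -> open V -> open (U `*` V).
Proof.
move=> oU oV; have -> : U `*` V = fst @^-1` U `&` snd @^-1` V by [].
by apply: openI; apply: open_comp => // x _; [exact: cvg_fst | exact: cvg_snd].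
Qed.

Lemma openXT (E F : topologicalType) (U : set E) :
  open U -> open (U `*` [set: F]).
Proof. by move=> oU; apply: openX => //; exact: openT. Qed.

(** The differentials given locally are unknown off their domains, so they are
    glued by redefining the differential as the limit of the difference
    quotients; uniqueness of limits identifies it with each local one. *)
Lemma Ck_local n (E F : tvsType R) (U : set E) (f : E -> F) :
  hausdorff_space F ->
  (forall x, U x -> exists V, [/\ open V, V x & Ck n V f]) -> Ck n U f.
Proof.
move=> hF; elim: n E U f => [|n IH] E U f loc.
  by split=> // x /loc[V [_ Vx [cf _]]]; exact: cf.
split; first by move=> x /loc[V [_ Vx [cf _]]]; exact: cf.
pose quot (z : E * E) :=
  h^-1 *: (f (h *: z.2 + z.1) - f z.1) @[h --> (0 : R)^'].
pose df (z : E * E) : F := xget 0 [set l | quot z --> l].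
have dfE z l : quot z --> l -> df z = l.
  move=> ql; rewrite /df; case: xgetP => [l' _ ql'|/(_ l) //].
  exact: (cvg_unique hF ql' ql).
exists df; split.
  move=> x v /loc[V [oV Vx [_ [g [gV _]]]]].
  by rewrite (dfE (x, v) (g (x, v)) (gV x v Vx)); exact: gV.
apply: IH => -[x v] [/= /loc[V [oV Vx [_ [g [gV Cg]]]]] _].
exists (V `*` setT); split => //; first exact: openXT.
apply: eq_Ck Cg; first exact: openXT.
by move=> [y w] [/= Vy _]; rewrite (dfE (y, w) _ (gV y w Vy)).
Qed.

Lemma Ck_linear n (E F : tvsType R) (f : E -> F) :
  linear f -> continuous f -> Ck n setT f.
Proof.
elim: n E f => [|n IH] E f lf cf; split=> //; try by move=> x _; exact: cf.
exists (f \o snd); split.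
  move=> x v _; apply: cvg_near_cst; near=> h.
  have h0 : h != 0 by near: h; exact: nbhs_dnbhs_neq.
  by rewrite lf addrK scalerA mulVf // scale1r.
rewrite setXTT; apply: IH; first by move=> a u v /=; rewrite lf.
by move=> z; apply: continuous_comp; [exact: cvg_snd | exact: cf].
Unshelve. all: by end_near. Qed.

Lemma Ck_fst n (E F : tvsType R) : Ck n setT (@fst E F).
Proof. by apply: Ck_linear => // z; exact: cvg_fst. Qed.

Lemma Ck_snd n (E F : tvsType R) : Ck n setT (@snd E F).
Proof. by apply: Ck_linear => // z; exact: cvg_snd. Qed.

Lemma Ck_id n (E : tvsType R) : Ck n setT (@id E).
Proof. by apply: Ck_linear => // z; exact: cvg_id. Qed.

Lemma Ck_cst n (E F : tvsType R) (U : set E) (y : F) : Ck n U (fun=> y).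
Proof.
elim: n E U y => [|n IH] E U y; split=> //; try by move=> x _; exact: cvg_cst.
exists (fun=> 0); split; last exact: IH.
by move=> x v _; apply: cvg_near_cst; near=> h; rewrite subrr scaler0.
Unshelve. all: by end_near. Qed.

Lemma Ck_pair n (E F H : tvsType R) (U : set E) (f : E -> F) (g : E -> H) :
  Ck n U f -> Ck n U g -> Ck n U (fun x => (f x, g x)).
Proof.
elim: n E F H U f g => [|n IH] E F H U f g [cf df] [cg dg]; split=> //;
  try by move=> x Ux; apply: cvg_pair; [exact: cf | exact: cg].
case: df => df [fdf Cdf]; case: dg => dg [gdg Cdg].
exists (fun z => (df z, dg z)); split; last exact: IH.
by move=> x v Ux; apply: cvg_pair; [exact: fdf | exact: gdg].
Qed.

(** The quotient at h is the slope over the segment from 0 to h of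
    t -> f (t *: w h + x), and the slopes of this curve at a point t are close
    to df (t *: w h + x, w h).  By continuity of df that value lies in a given
    open convex neighbourhood K of df (x, v) once h is small, hence so does the
    quotient by the mean value theorem. *)
Lemma cvg_difference_quotient (E F : tvsType R) (U : set E) (f : E -> F)
    (df : E * E -> F) (x v : E) : open U -> U x ->
  (forall x v, U x ->
     h^-1 *: (f (h *: v + x) - f x) @[h --> (0 : R)^'] --> df (x, v)) ->
  {for (x, v), continuous df} ->
  forall w : R -> E, w h @[h --> (0 : R)^'] --> v ->
  h^-1 *: (f (h *: w h + x) - f x) @[h --> (0 : R)^'] --> df (x, v).
Proof.
move=> oU Ux fdf cdf w wv N /convex_nbhs[K [oK cK Kdf KN]].
have nearU : \forall z \near ((0, v) : R^o * E),
    U (z.1 *: z.2 + x) /\ K (df (z.1 *: z.2 + x, z.2)).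
  have c1 : z.1 *: z.2 + x @[z --> ((0, v) : R^o * E)] --> x.
    have := @line_continuous R E x (0, v).
    by rewrite /continuous_at /= scale0r add0r.
  have c2 : (z.1 *: z.2 + x, z.2) @[z --> ((0, v) : R^o * E)] -->
      ((x, v) : E * E).
    by apply: cvg_pair; [exact: c1 | exact: cvg_snd].
  have c3 := cvg_comp _ df c2 cdf.
  near=> z; split; near: z.
    by apply: c1; exact: open_nbhs_nbhs.
  by apply: c3; exact: open_nbhs_nbhs.
case: nearU => -[/= B W] [/= /near0_ball[d d0 dB] Wv] BW.
suff : \forall h \near (0 : R)^', K (h^-1 *: (f (h *: w h + x) - f x)).
  by apply: filterS => h; exact: KN.
near=> h.
have h0 : h != 0 by near: h; exact: nbhs_dnbhs_neq.
have Ww : W (w h) by near: h; exact: wv.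
have hd : `|h| < d.
  by near: h; exact: dnbhs0_lt.
pose g (t : R) := f (t *: w h + x).
have -> : h^-1 *: (f (h *: w h + x) - f x) = slope g 0 h.
  by rewrite /slope /g subr0 scale0r add0r.
(* K is open, so it contains the slopes near t once it contains their limit. *)
have loc t : `|t| < d -> exists2 e, 0 < e &
    forall s, s != t -> `|s - t| < e -> K (slope g t s).
  move=> td; have [/= Ut Kt] := BW (t, w h) (conj (dB t td) Ww).
  have := fdf _ (w h) Ut K (open_nbhs_nbhs (conj oK Kt)).
  move=> /dnear0_ball[e e0 eK]; exists e => // s st /eK.
  rewrite subr_eq0 => /(_ st) /=.
  by rewrite addrA -scalerDl subrK.
have : h < 0 \/ 0 < h by apply/orP; rewrite -neq_lt.
case=> [hl|hg]; last first.
  apply: mean_value => // t /andP[t0 th]; apply: loc.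
  by rewrite ger0_norm // (le_lt_trans th) // -[h]ger0_norm // ltW.
rewrite slopeC; apply: mean_value => // t /andP[ht t0]; apply: loc.
rewrite ler0_norm //; apply: le_lt_trans hd; rewrite ler0_norm ?lerN2 //.
exact: ltW.
Unshelve. all: by end_near. Qed.

(** The differential of the composite is dg composed with
    (x, v) -> (f x, df (x, v)), which is again a composite of maps of one order
    of differentiability less; hence the induction. *)
Lemma Ck_comp n (E F H : tvsType R) (U : set E) (V : set F) (f : E -> F)
    (g : F -> H) : open U -> open V -> (forall x, U x -> V (f x)) ->
  Ck n U f -> Ck n V g -> Ck n U (g \o f).
Proof.
elim: n E F H U V f g => [|n IH] E F H U V f g oU oV UV Cf Cg.
  case: Cf Cg => cf _ [cg _]; split => // x Ux.
  by apply: continuous_comp; [exact: cf | apply: cg; exact: UV].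
have Cf' := CkW Cf.
case: Cf Cg => cf [df [fdf Cdf]] [cg [dg [gdg Cdg]]]; split.
  by move=> x Ux; apply: continuous_comp; [exact: cf | apply: cg; exact: UV].
exists (dg \o (fun z => (f z.1, df z))); split.
  move=> x v Ux /=.
  have cdg : {for (f x, df (x, v)), continuous dg}.
    by apply: (Ck_continuous Cdg); split => //; exact: UV.
  (* The varying direction is the difference quotient w h of f, for which
     h *: w h + f x = f (h *: v + x). *)
  have := cvg_difference_quotient oV (UV x Ux) gdg cdg (fdf x v Ux).
  apply: cvg_trans; apply: near_eq_cvg; near=> h.
  have h0 : h != 0 by near: h; exact: nbhs_dnbhs_neq.
  by rewrite scalerA mulfV // scale1r subrK.
apply: (IH _ _ _ _ (V `*` setT)) => //.
- exact: openXT.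
- exact: openXT.
- by move=> [y w] [/= Uy _]; split => //; exact: UV.
apply: Ck_pair => //.
apply: (IH _ _ _ _ U fst f) => //; first exact: openXT.
  by move=> y [].
by apply: Ck_subset (Ck_fst _ _ _).
Unshelve. all: by end_near. Qed.

End CkBasics.

(** * Products of Frechet spaces *)

Section FrechetSpaces.

Lemma hausdorff_prod (S T : topologicalType) :
  hausdorff_space S -> hausdorff_space T -> hausdorff_space (S * T)%type.
Proof.
move=> hS hT [x y] [x' y'] cl; congr pair.
- apply: hS => U V xU x'V.
  have xyU : nbhs (x, y) (fst @^-1` U) by exact: (@cvg_fst _ _ (nbhs x)).
  have xyV : nbhs (x', y') (fst @^-1` V) by exact: (@cvg_fst _ _ (nbhs x')).
  by have [z [Uz Vz]] := cl _ _ xyU xyV; exists z.1.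
- apply: hT => U V yU y'V.
  have xyU : nbhs (x, y) (snd @^-1` U) by exact: (@cvg_snd _ _ _ (nbhs y)).
  have xyV : nbhs (x', y') (snd @^-1` V) by exact: (@cvg_snd _ _ _ (nbhs y')).
  by have [z [Uz Vz]] := cl _ _ xyU xyV; exists z.2.
Qed.

Lemma nbhs_setX (S T : topologicalType) (z : S * T) (U : set S) (V : set T) :
  nbhs z.1 U -> nbhs z.2 V -> nbhs z (U `*` V).
Proof. by move=> zU zV; exists (U, V). Qed.

Lemma is_frechet_prod (K : numFieldType) (E F : tvsType K) :
  is_frechet E -> is_frechet F -> is_frechet (E * F)%type.
Proof.
move=> [hE [B [B0 BU]] cE] [hF [C [C0 CU]] cF]; split.
- exact: hausdorff_prod.
- exists (fun n => if unpickle n is Some (i, j) then B i `*` C j else setT).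
  split.
    move=> n; case: unpickle => [[i j]|]; last exact: filterT.
    exact: nbhs_setX.
  move=> U [[V W] [/= /BU[i iV] /CU[j jW]] VWU].
  exists (pickle (i, j)); rewrite pickleK => -[a b] [/= /iV Va /jW Wb].
  exact: VWU.
- move=> u cu.
  have [|l ul] := cE (fun n => (u n).1).
    move=> U U0; have [|N uN] := cu (U `*` setT).
      by apply: nbhs_setX => //; exact: filterT.
    by exists N => m n Nm Nn; have [] := uN m n Nm Nn.
  have [|l' ul'] := cF (fun n => (u n).2).
    move=> U U0; have [|N uN] := cu (setT `*` U).
      by apply: nbhs_setX => //; exact: filterT.
    by exists N => m n Nm Nn; have [] := uN m n Nm Nn.
  exists (l, l'); have -> : u = (fun n => ((u n).1, (u n).2)).
    by apply/funext => n; case: (u n).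
  by apply: cvg_pair; [exact: ul | exact: ul'].
Qed.

Lemma is_frechet_realify (R : realType) (E : tvsType R[i]) :
  is_frechet E -> is_frechet (realify E).
Proof. by move=> [hE cE sE]; split. Qed.

End FrechetSpaces.

(** * Smooth maps between manifolds and descent along submersions *)

Section Manifolds.
Variable R : realType.
Implicit Types M N Q : atlasSpace R.

Lemma open_preimage_on (S T : topologicalType) (D : set S) (O : set T)
    (f : S -> T) :
  open D -> open O -> (forall x, D x -> {for x, continuous f}) ->
  open (D `&` f @^-1` O).
Proof.
move=> oD oO cf; rewrite openE => x [Dx Ofx]; apply: filterI.
  exact: open_nbhs_nbhs.
by apply: (cf x Dx); exact: open_nbhs_nbhs.
Qed.

Lemma open_chart_preimage (M : topologicalType) (E : tvsType R) (c : chart M E)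
    (O : set M) : is_chart c -> open O -> open (c_cod c `&` c_inv c @^-1` O).
Proof.
move=> hc oO; apply: open_preimage_on (chart_inv_cont hc) => //.
exact: chart_cod.
Qed.

Lemma is_frechet_manifold_tvs (E : tvsType R) :
  is_frechet E -> is_frechet_manifold (tvs_space E).
Proof.
move=> hE; split.
- by case: hE.
- move=> F c [] {F c}; split => //=; try exact: openT.
  + by move=> x _; exact: cvg_id.
  + by move=> x _; exact: cvg_id.
- by move=> x; exists E, (Chart setT setT id id); split.
- move=> F F' c d [] {F c} [] {F' d} n.
  by apply: Ck_subset (Ck_id _ _).
Qed.

Lemma is_chart_prod (M N : topologicalType) (E F : tvsType R) (c : chart M E)
    (d : chart N F) : is_chart c -> is_chart d -> is_chart (prod_chart c d).
Proof.
move=> [mc oc oc' cK cV cc cc'] [md od od' dK dV dc dc']; split => /=.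
- exact: is_frechet_prod.
- exact: openX.
- exact: openX.
- by move=> [x y] [/= /cK[? ->] /dK[? ->]].
- by move=> [x y] [/= /cV[? ->] /dV[? ->]].
- move=> [x y] [/= Dx Dy]; apply: cvg_pair.
  + by apply: continuous_comp; [exact: cvg_fst | exact: cc].
  + by apply: continuous_comp; [exact: cvg_snd | exact: dc].
- move=> [x y] [/= Dx Dy]; apply: cvg_pair.
  + by apply: continuous_comp; [exact: cvg_fst | exact: cc'].
  + by apply: continuous_comp; [exact: cvg_snd | exact: dc'].
Qed.

Lemma Ck_fst_comp n (E F H : tvsType R) (U : set E) (W : set (E * F))
    (f : E -> H) : open U -> open W -> (forall z, W z -> U z.1) ->
  Ck n U f -> Ck n W (fun z => f z.1).
Proof.
move=> oU oW WU; apply: (@Ck_comp _ _ _ _ _ W U fst f) => //.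
exact: Ck_subset (Ck_fst _ _ _).
Qed.

Lemma Ck_snd_comp n (E F H : tvsType R) (U : set F) (W : set (E * F))
    (f : F -> H) : open U -> open W -> (forall z, W z -> U z.2) ->
  Ck n U f -> Ck n W (fun z => f z.2).
Proof.
move=> oU oW WU; apply: (@Ck_comp _ _ _ _ _ W U snd f) => //.
exact: Ck_subset (Ck_snd _ _ _).
Qed.

Lemma is_frechet_manifold_prod M N : is_frechet_manifold M ->
  is_frechet_manifold N -> is_frechet_manifold (prod_space M N).
Proof.
move=> [hM cM vM tM] [hN cN vN tN]; split.
- exact: hausdorff_prod.
- move=> G c [] E F {}c d ac ad.
  by apply: is_chart_prod; [exact: cM | exact: cN].
- move=> [x y]; have [E [c [ac cx]]] := vM x; have [F [d [ad dy]]] := vN y.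
  by exists (E * F)%type, (prod_chart c d); split.
- move=> G G' c c' [] E F {G}{}c d ac ad [] E' F' {G'}{}c' d' ac' ad' n.
  have [hc hd] := (cM _ _ ac, cN _ _ ad).
  have [hc' hd'] := (cM _ _ ac', cN _ _ ad').
  have oW := open_chart_preimage (is_chart_prod hc hd)
    (chart_dom (is_chart_prod hc' hd')).
  apply: Ck_pair.
  + apply: (Ck_fst_comp (f := c_map c' \o c_inv c)
      (open_chart_preimage hc (chart_dom hc')) oW).
      by move=> z [[? _] [? _]]; split.
    exact: tM.
  + apply: (Ck_snd_comp (f := c_map d' \o c_inv d)
      (open_chart_preimage hd (chart_dom hd')) oW).
      by move=> z [[_ ?] [_ ?]]; split.
    exact: tN.
Qed.

Lemma smooth_on_subset M N (D D' : set M) (f : M -> N) :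
  D' `<=` D -> smooth_on D f -> smooth_on D' f.
Proof.
move=> DD [cf sf]; split; first by move=> x /DD; exact: cf.
move=> E F c d ac ad n; apply: Ck_subset (sf _ _ _ _ ac ad n).
by move=> u [? [/DD ? ?]].
Qed.

Lemma eq_smooth_on M N (D : set M) (f g : M -> N) : is_frechet_manifold M ->
  is_frechet_manifold N -> open D -> (forall x, D x -> f x = g x) ->
  smooth_on D f -> smooth_on D g.
Proof.
move=> hM hN oD fg [cf sf]; split.
  move=> x Dx; change (g @ nbhs x --> g x); rewrite -(fg x Dx).
  apply: cvg_trans (cf x Dx); apply: near_eq_cvg.
  by near=> y; apply: fg; near: y; exact: open_nbhs_nbhs.
move=> E F c d ac ad n.
have [hc hd] := (manifold_chart hM ac, manifold_chart hN ad).
rewrite (_ : D `&` g @^-1` _ = D `&` f @^-1` c_dom d); last first.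
  by apply/seteqP; split=> x [Dx] /=; rewrite fg.
apply: eq_Ck (sf _ _ _ _ ac ad n).
  apply: open_chart_preimage => //; apply: open_preimage_on => //.
  exact: chart_dom.
by move=> u [_ [Du _]] /=; rewrite fg.
Unshelve. all: by end_near. Qed.

Lemma smooth_on_local M N (D : set M) (f : M -> N) : is_frechet_manifold M ->
  is_frechet_manifold N ->
  (forall x, D x -> exists V, [/\ open V, V x & smooth_on V f]) ->
  smooth_on D f.
Proof.
move=> hM hN loc; split; first by move=> x /loc[V [_ Vx [cf _]]]; exact: cf.
move=> E F c d ac ad n.
have [hc hd] := (manifold_chart hM ac, manifold_chart hN ad).
apply: Ck_local; first exact: frechet_hausdorff (chart_model hd).
move=> u [cu [/loc[V [oV Vu [cf sf]]] du]].
exists (c_cod c `&` c_inv c @^-1` (V `&` f @^-1` c_dom d)); split => //.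
  apply: open_chart_preimage => //; apply: open_preimage_on => //.
  exact: chart_dom.
exact: sf.
Qed.

(** Smoothness of g composed with f is tested in charts at the two ends; near
    each point a chart of the middle manifold is inserted between the two
    maps, and the chain rule applies. *)
Lemma smooth_on_comp M N Q (D : set M) (D' : set N) (f : M -> N) (g : N -> Q) :
  is_frechet_manifold M -> is_frechet_manifold N -> is_frechet_manifold Q ->
  open D -> open D' -> (forall x, D x -> D' (f x)) ->
  smooth_on D f -> smooth_on D' g -> smooth_on D (g \o f).
Proof.
move=> hM hN hQ oD oD' DD' [cf sf] [cg sg].
have cgf x : D x -> {for x, continuous (g \o f)}.
  by move=> Dx; apply: continuous_comp; [exact: cf | apply: cg; exact: DD'].
split=> // E F c d ac ad n.
have [hc hd] := (manifold_chart hM ac, manifold_chart hQ ad).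
apply: Ck_local; first exact: frechet_hausdorff (chart_model hd).
move=> u [cu [Du du]].
have [H [e [ae eu]]] := manifold_cover hN (f (c_inv c u)).
have he := manifold_chart hN ae.
have oP : open (D' `&` g @^-1` c_dom d).
  by apply: open_preimage_on => //; exact: chart_dom.
pose V := c_cod c `&` c_inv c @^-1`
  (D `&` f @^-1` (c_dom e `&` (D' `&` g @^-1` c_dom d))).
have oV : open V.
  apply: open_chart_preimage => //; apply: open_preimage_on => //.
  by apply: openI => //; exact: chart_dom.
exists V; split => //.
  by split => //; split => //; split => //; split => //; exact: DD'.
have := @Ck_comp _ n _ _ _ V
  (c_cod e `&` c_inv e @^-1` (D' `&` g @^-1` c_dom d))
  (c_map e \o f \o c_inv c) (c_map d \o g \o c_inv e) oV
  (open_chart_preimage he oP).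
move=> /(_ _ _ (sg _ _ _ _ ae ad n)) h.
apply: eq_Ck (h _ _) => //.
- by move=> v [_ [_ [/(chart_mapK he)[_ /= ->] _]]].
- move=> v [_ [_ [/(chart_mapK he)[ev eK] [D'v gv]]]]; split => //=.
  by rewrite eK.
- by apply: Ck_subset (sf _ _ _ _ ac ae n) => v [cv [Dv [? _]]].
Qed.

Lemma smooth_cst M N (y : N) : smooth (fun _ : M => y).
Proof.
split; first by move=> x _; exact: cvg_cst.
by move=> E F c d ac ad n; exact: Ck_cst.
Qed.

Lemma smooth_on_pair M N Q (D : set M) (f : M -> N) (g : M -> Q) :
  smooth_on D f -> smooth_on D g ->
  smooth_on (N := prod_space N Q) D (fun x => (f x, g x)).
Proof.
move=> [cf sf] [cg sg]; split.
  by move=> x Dx; apply: cvg_pair; [exact: cf | exact: cg].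
move=> E F c d ac [] {F d} E1 E2 d e ad ae n; apply: Ck_pair.
- by apply: Ck_subset (sf _ _ _ _ ac ad n) => u [? [? []]].
- by apply: Ck_subset (sg _ _ _ _ ac ae n) => u [? [? []]].
Qed.

Lemma smooth_fst M N : is_frechet_manifold M -> is_frechet_manifold N ->
  smooth (M := prod_space M N) (@fst M N).
Proof.
move=> hM hN; split; first by move=> x _; exact: cvg_fst.
move=> E F c c' [] {E c} E1 E2 c d ac ad ac' n.
have [hc hd] := (manifold_chart hM ac, manifold_chart hN ad).
have hc' := manifold_chart hM ac'.
have oW := open_chart_preimage (is_chart_prod hc hd)
  (openXT (F := N) (chart_dom hc')).
apply: (Ck_subset _ (Ck_fst_comp
  (f := c_map c' \o c_inv c) (open_chart_preimage hc (chart_dom hc')) oW _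
  (manifold_compat hM ac ac' n))).
  by move=> z [? [_ ?]].
by move=> z [[? _] [? _]].
Qed.

Lemma smooth_snd M N : is_frechet_manifold M -> is_frechet_manifold N ->
  smooth (M := prod_space M N) (@snd M N).
Proof.
move=> hM hN; split; first by move=> x _; exact: cvg_snd.
move=> E F c d' [] {E c} E1 E2 c d ac ad ad' n.
have [hc hd] := (manifold_chart hM ac, manifold_chart hN ad).
have hd' := manifold_chart hN ad'.
have oW := open_chart_preimage (is_chart_prod hc hd)
  (openX (@openT M) (chart_dom hd')).
apply: (Ck_subset _ (Ck_snd_comp
  (f := c_map d' \o c_inv d) (open_chart_preimage hd (chart_dom hd')) oW _
  (manifold_compat hN ad ad' n))).
  by move=> z [? [_ ?]].
by move=> z [[_ ?] [_ ?]].
Qed.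

Lemma smooth_on_tvs (E F : tvsType R) (U : set E) (f : E -> F) :
  Cinf U f -> smooth_on (M := tvs_space E) (N := tvs_space F) U f.
Proof.
move=> Cf; split; first exact: Ck_continuous (Cf 0%N).
move=> E' F' c d [] {E' c} [] {F' d} n; apply: Ck_subset (Cf n).
by move=> u [_ []].
Qed.

Lemma smooth_chart_map M (E : tvsType R) (c : chart M E) : smooth_chart c ->
  smooth_on (N := tvs_space E) (c_dom c) (c_map c).
Proof.
move=> [hc tc]; split; first exact: chart_map_cont.
move=> F F' d c' ad [] {F' c'} n; apply: Ck_subset ((tc _ _ ad).2 n).
by move=> u [? []].
Qed.

Lemma smooth_chart_inv M (E : tvsType R) (c : chart M E) : smooth_chart c ->
  smooth_on (M := tvs_space E) (c_cod c) (c_inv c).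
Proof.
move=> [hc tc]; split; first exact: chart_inv_cont.
move=> F F' c' d [] {F c'} ad n; apply: Ck_subset ((tc _ _ ad).1 n).
by move=> u [_ []].
Qed.

(** In charts where q is the projection of a product, the section is the
    inclusion of the factor through the point x. *)
Lemma submersion_section M N (q : M -> N) (x : M) : is_frechet_manifold M ->
  is_frechet_manifold N -> submersion q ->
  exists (W : set N) (s : N -> M),
    [/\ open W, W (q x), smooth_on W s & forall y, W y -> q (s y) = y].
Proof.
move=> hM hN [_ /(_ x)[E [F [c [d [sc sd cx cq]]]]]].
have [[hc _] [hd _]] := (sc, sd).
have [mEF mE] := (chart_model hc, chart_model hd).
have tEF := is_frechet_manifold_tvs mEF.
have tE := is_frechet_manifold_tvs mE.
pose i (u : E) : E * F := (u, (c_map c x).2).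
have Ci : Cinf setT i.
  by move=> n; apply: Ck_pair; [exact: Ck_id | exact: Ck_cst].
have oi : open (i @^-1` c_cod c).
  apply: open_comp; last exact: chart_cod.
  by move=> u _; exact: (Ck_continuous (Ci 0%N)).
have oW : open (c_dom d `&` c_map d @^-1` (i @^-1` c_cod c)).
  by apply: open_preimage_on (chart_map_cont hd) => //; exact: chart_dom.
have [dqx dq] := cq x cx.
exists (c_dom d `&` c_map d @^-1` (i @^-1` c_cod c)), (c_inv c \o i \o c_map d).
split => //.
- split => //; rewrite /preimage /= /i dq -surjective_pairing.
  by have [] := chart_mapK hc cx.
- apply: (smooth_on_comp (N := tvs_space E) (D' := i @^-1` c_cod c)) => //.
  + by move=> y [].
  + by apply: smooth_on_subset (smooth_chart_map sd) => y [].
  apply: (smooth_on_comp (N := tvs_space (E * F)%type) (D' := c_cod c)) => //.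
  + exact: chart_cod.
  + apply: smooth_on_tvs => n; exact: Ck_subset (Ci n).
  + exact: smooth_chart_inv.
- move=> y [dy /= cy]; have [ciy ciK] := chart_invK hc cy.
  have [dqy] := cq _ ciy; rewrite ciK /= => dqE.
  have [_ <-] := chart_mapK hd dqy; rewrite dqE.
  by have [] := chart_mapK hd dy.
Qed.

(** Locally f is the composite of the smooth map f \o q with a smooth section
    of q. *)
Lemma submersion_descent M N Q (q : M -> N) (f : N -> Q) (D : set N) :
  is_frechet_manifold M -> is_frechet_manifold N -> is_frechet_manifold Q ->
  submersion q -> (forall y, exists x, q x = y) -> open D ->
  smooth_on (q @^-1` D) (f \o q) -> smooth_on D f.
Proof.
move=> hM hN hQ sq surj oD sfq; apply: smooth_on_local => // y Dy.
have [x qx] := surj y.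
have [W [s [oW Wx sW sK]]] := submersion_section x hM hN sq.
exists (D `&` W); split; [exact: openI | by split => //; rewrite -qx |].
have oqD : open (q @^-1` D).
  by apply: open_comp => // z _; case: sq => -[cq _] _; exact: cq.
apply: (@eq_smooth_on _ _ _ ((f \o q) \o s)) => //; first exact: openI.
  by move=> z [_ Wz] /=; rewrite sK.
apply: (smooth_on_comp (D' := q @^-1` D)) => //; first exact: openI.
  by move=> z [Dz Wz]; rewrite /preimage /= sK.
by apply: smooth_on_subset sW => z [].
Qed.

End Manifolds.

(** * Module structures transported along a bijection *)

Section Transport.
Variables (K : pzRingType) (V : lmodType K) (T : Type).
Variables (f : T -> V) (g : V -> T) (fK : cancel f g) (gK : cancel g f).

(** An alias of T whose parameters record the bijection, so that structures can
    be attached to it without touching those of T. *)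
Definition transport_type of cancel f g & cancel g f : Type := T.
Local Notation W := (transport_type fK gK).

HB.instance Definition _ := Choice.copy W (can_type fK).

Definition transport_add (u v : W) : W := g (f u + f v).
Definition transport_opp (u : W) : W := g (- f u).
Definition transport_scale (k : K) (u : W) : W := g (k *: f u).

Fact transport_addA : associative transport_add.
Proof. by move=> u v w; rewrite /transport_add !gK addrA. Qed.
Fact transport_addC : commutative transport_add.
Proof. by move=> u v; rewrite /transport_add addrC. Qed.
Fact transport_add0 : left_id (g 0 : W) transport_add.
Proof. by move=> u; rewrite /transport_add gK add0r fK. Qed.
Fact transport_addN : left_inverse (g 0 : W) transport_opp transport_add.
Proof. by move=> u; rewrite /transport_add gK addNr. Qed.

HB.instance Definition _ := GRing.isZmodule.Build W
  transport_addA transport_addC transport_add0 transport_addN.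

Fact transport_scaleA a b v :
  transport_scale a (transport_scale b v) = transport_scale (a * b) v.
Proof. by rewrite /transport_scale gK scalerA. Qed.
Fact transport_scale1 : left_id 1 transport_scale.
Proof. by move=> v; rewrite /transport_scale scale1r fK. Qed.
Fact transport_scaleDr : right_distributive transport_scale +%R.
Proof.
move=> a u v.
by rewrite /transport_scale /GRing.add /= /transport_add !gK scalerDr.
Qed.
Fact transport_scaleDl v : {morph transport_scale^~ v : a b / a + b}.
Proof.
move=> a b.
by rewrite /transport_scale scalerDl /GRing.add /= /transport_add !gK.
Qed.

HB.instance Definition _ := GRing.Zmodule_isLmodule.Build K W
  transport_scaleA transport_scale1 transport_scaleDr transport_scaleDl.

Definition transport_lmod : GRing.Lmodule K T :=
  GRing.Lmodule.class (W : lmodType K).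

Lemma transport_linear : linear (f : GRing.Lmodule.Pack transport_lmod -> V).
Proof.
move=> k u v; rewrite /= /GRing.add /= /transport_add.
by rewrite /GRing.scale /= /transport_scale !gK.
Qed.

End Transport.

(** * Fibres of a principal bundle *)

Section PrincipalFibres.
Variables (R : realType) (G : frechetLieGroup R) (M : frechetManifold R).
Variable P : principalBundle G M.
Implicit Types (p q : P) (g h : G).

(** In a local trivialisation the action is right translation in the group. *)
Lemma act_free p g : pb_act p g = p -> g = 1%g.
Proof.
move=> pg; have [U [phi [_ Up _ _ phiM]]] := pb_triv P (pb_proj p).
by have := phiM p g Up; rewrite pg -[LHS]mulg1 => /mulgI.
Qed.

Lemma act_transitive p q : pb_proj p = pb_proj q -> exists g, q = pb_act p g.
Proof.
move=> pq; have [U [phi [_ Up [_ _ _ [psi [_ psiK _]]] phi1 phiM]]] :=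
  pb_triv P (pb_proj p).
have Uq : U (pb_proj q) by rewrite -pq.
exists ((phi p).2^-1 * (phi q).2)%g; set g := (_ * _)%g.
have Upg : U (pb_proj (pb_act p g)) by rewrite pb_proj_act.
have phi_pg : phi (pb_act p g) = phi q.
  rewrite [LHS]surjective_pairing [RHS]surjective_pairing; congr pair.
    by rewrite !phi1 // pb_proj_act.
  by rewrite phiM // /g mulgA mulgV mul1g.
by rewrite -(psiK q Uq).2 -phi_pg (psiK _ Upg).2.
Qed.

Lemma proj_surj (x : M) : exists p : P, pb_proj p = x.
Proof.
have [U [phi [_ Ux [_ _ _ [psi [_ _ psiK]]] phi1 _]]] := pb_triv P x.
have [Up phiK] := psiK (x, 1%g) (conj Ux I).
by exists (psi (x, 1%g)); rewrite -phi1 // phiK.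
Qed.

End PrincipalFibres.

(** * The associated bundle *)

Section AssociatedFibres.
Variables (R : realType) (G : frechetLieGroup R) (M : frechetManifold R).
Variables (P : principalBundle G M) (A : riggedCstar R) (rho : smoothRep G A).
Implicit Types (p q : P) (a b : A) (g h : G).

Local Notation cls p a := (assoc_class rho (p, a)).
Local Notation proj := (assoc_proj (P := P) rho).
Local Notation quo := (assoc_class (P := P) rho).
Local Notation projP := (@pb_proj R G M P).
Local Open Scope quotient_scope.

Lemma rep_linear g : linear (rho g).
Proof. exact: rigged_morphism_linear (rep_morphism rho g). Qed.

Lemma assoc_class_eqP p q a b :
  cls p a = cls q b <-> exists g, q = pb_act p g /\ b = rho g^-1%g a.
Proof.
split.
  by move=> /eqmodP/asboolP[g [-> ->]]; exists g.
by move=> [g [-> ->]]; apply/eqmodP/asboolP; exists g.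
Qed.

Lemma assoc_class_act p g a : cls (pb_act p g) a = cls p (rho g a).
Proof.
apply/esym/assoc_class_eqP; exists g; split => //.
by rewrite -repM mulVg rep1.
Qed.

(** This is where freeness of the action is used: [p, a] = [p, b] forces the
    group element that relates them to fix p. *)
Lemma assoc_class_inj p : injective (fun a => cls p a).
Proof.
move=> a b /assoc_class_eqP[g [/esym/act_free -> ->]].
by rewrite invg1 rep1.
Qed.

Definition assoc_repr (e : assoc_total P rho) : assoc_pair P A :=
  repr (e : quotient_topology {eq_quot assoc_equiv P rho}).

Lemma assoc_class_repr e : cls (assoc_repr e).1 (assoc_repr e).2 = e.
Proof. by rewrite -surjective_pairing; exact: reprK. Qed.

Lemma assoc_class_surj p e : proj e = pb_proj p -> exists a, cls p a = e.
Proof.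
move=> /esym /act_transitive[g eg]; exists (rho g (assoc_repr e).2).
by rewrite -assoc_class_act -eg assoc_class_repr.
Qed.

(** An arbitrary point over x, which turns the fibre of the associated bundle
    over x into a copy of A. *)
Definition base_point (x : M) : P := sval (cid (proj_surj P x)).

Lemma base_pointP x : pb_proj (base_point x) = x.
Proof. exact: svalP (cid (proj_surj P x)). Qed.

Fact fibre_elt_subproof x a : proj (cls (base_point x) a) == x.
Proof. by rewrite -{2}(base_pointP x) assoc_projE. Qed.

Definition fibre_elt x a : fibre proj x :=
  exist _ (cls (base_point x) a) (fibre_elt_subproof x a).

Fact fibre_coord_subproof x (e : fibre proj x) :
  exists a, cls (base_point x) a = sval e.
Proof.
by apply: assoc_class_surj; rewrite base_pointP; apply/eqP/(svalP e).
Qed.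

Definition fibre_coord x (e : fibre proj x) : A :=
  sval (cid (fibre_coord_subproof e)).

Lemma fibre_coordE x (e : fibre proj x) :
  cls (base_point x) (fibre_coord e) = sval e.
Proof. exact: svalP (cid (fibre_coord_subproof e)). Qed.

Lemma fibre_coordK x : cancel (@fibre_coord x) (@fibre_elt x).
Proof. by move=> e; apply: val_inj; exact: fibre_coordE. Qed.

Lemma fibre_eltK x : cancel (@fibre_elt x) (@fibre_coord x).
Proof.
move=> a; apply: (@assoc_class_inj (base_point x)).
by rewrite /= fibre_coordE.
Qed.

Definition assoc_lmod : fibre_lmod R proj :=
  fun x => transport_lmod (@fibre_coordK x) (@fibre_eltK x).

Local Notation L := assoc_lmod.

(** [fibre_coord] with its domain seen as a module, so that it can be declared
    linear. *)
Definition fib_coord x (u : fib L x) : A := fibre_coord u.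

Fact fib_coord_is_linear x : linear (@fib_coord x).
Proof. exact: transport_linear. Qed.

HB.instance Definition _ x :=
  GRing.isLinear.Build R[i] (fib L x) A _
    (@fib_coord x) (@fib_coord_is_linear x).

Lemma fib_coord_inj x : injective (@fib_coord x).
Proof. exact: can_inj (@fibre_coordK x). Qed.

Definition assoc_norm (e : assoc_total P rho) : R := rc_norm (assoc_repr e).2.

Lemma assoc_normE p a : assoc_norm (cls p a) = rc_norm a.
Proof.
have /esym/assoc_class_eqP[g [_ ga]] := assoc_class_repr (cls p a).
by rewrite /assoc_norm ga rep_isometric.
Qed.

Lemma assoc_normE_coord x (u : fib L x) :
  assoc_norm (fib_val u) = rc_norm (fib_coord u).
Proof. by rewrite /fib_val -fibre_coordE assoc_normE. Qed.

Definition assoc_mul x (u v : fib L x) : fib L x :=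
  fibre_elt x (rc_mul (fib_coord u) (fib_coord v)).

Definition assoc_star x (u : fib L x) : fib L x :=
  fibre_elt x (rc_star (fib_coord u)).

Lemma fib_coord_mul x (u v : fib L x) :
  fib_coord (assoc_mul u v) = rc_mul (fib_coord u) (fib_coord v).
Proof. exact: fibre_eltK. Qed.

Lemma fib_coord_star x (u : fib L x) :
  fib_coord (assoc_star u) = rc_star (fib_coord u).
Proof. exact: fibre_eltK. Qed.

(** The identification of the fibre with A given by p differs from the one given
    by the chosen base point by the action of one group element.  Since that
    action preserves all the structure of A, the structure of the fibre does
    not depend on the base point. *)
Lemma fib_coord_elt p :
  exists g, forall a, fib_coord (assoc_elt rho p a : fib L _) = rho g a.
Proof.
have [g pg] := act_transitive (base_pointP (pb_proj p)); exists g => a.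
apply: (@assoc_class_inj (base_point (pb_proj p))).
by rewrite fibre_coordE /= -assoc_class_act -pg.
Qed.

Lemma assoc_elt_linear p : linear (assoc_elt rho p : A -> fib L (pb_proj p)).
Proof.
move=> k a b; apply: fib_coord_inj; rewrite linearP /=.
by have [g gE] := fib_coord_elt p; rewrite !gE rep_linear.
Qed.

Lemma assoc_elt_mul p a b :
  assoc_mul (assoc_elt rho p a : fib L _) (assoc_elt rho p b) =
  assoc_elt rho p (rc_mul a b).
Proof.
apply: fib_coord_inj; rewrite fib_coord_mul; have [g gE] := fib_coord_elt p.
by rewrite !gE (rigged_morphism_mul (rep_morphism rho g)).
Qed.

Lemma assoc_elt_star p a :
  assoc_star (assoc_elt rho p a : fib L _) = assoc_elt rho p (rc_star a).
Proof.
apply: fib_coord_inj; rewrite fib_coord_star; have [g gE] := fib_coord_elt p.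
by rewrite !gE (rigged_morphism_star (rep_morphism rho g)).
Qed.

Lemma assoc_is_norm x : is_norm (fun u : fib L x => assoc_norm (fib_val u)).
Proof.
have [N0 Neq0 NZ ND] := rc_is_norm A.
split=> [v|v|k v|u v]; rewrite !assoc_normE_coord.
- exact: N0.
- by move=> /Neq0 v0; apply: fib_coord_inj; rewrite v0 linear0.
- by rewrite linearZ; exact: NZ.
- by rewrite linearD; exact: ND.
Qed.

Lemma assoc_is_star_algebra x : is_star_algebra (@assoc_mul x) (@assoc_star x).
Proof.
have [mA mDl mDr sD sK sM] := rc_algebra A; split.
- by move=> u v w; apply: fib_coord_inj; rewrite !fib_coord_mul mA.
- move=> w k u v; apply: fib_coord_inj.
  by rewrite linearP /= !fib_coord_mul linearP; exact: mDl.
- move=> w k u v; apply: fib_coord_inj.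
  by rewrite linearP /= !fib_coord_mul linearP; exact: mDr.
- move=> k u v; apply: fib_coord_inj.
  by rewrite linearP /= !fib_coord_star linearP; exact: sD.
- by move=> u; apply: fib_coord_inj; rewrite !fib_coord_star sK.
- move=> u v; apply: fib_coord_inj.
  by rewrite !(fib_coord_star, fib_coord_mul) sM.
Qed.

Definition assoc_triv (phi : P -> prod_space M (lg_space G))
    (e : assoc_total P rho) : prod_space M (rc_space A) :=
  (proj e, rho (phi (assoc_repr e).1).2 (assoc_repr e).2).

Lemma assoc_proj_class p a : proj (cls p a) = pb_proj p.
Proof. exact/eqP/assoc_projE. Qed.

Section Trivialisation.
Variables (U : set M) (phi : P -> prod_space M (lg_space G)).
Hypothesis phiM :
  forall p g, U (pb_proj p) -> (phi (pb_act p g)).2 = ((phi p).2 * g)%g.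

(** Replacing (p, a) by (p g, rho g^-1 a) multiplies the group coordinate of p
    by g on the right, which cancels the g^-1 acting on a. *)
Lemma assoc_trivE p a : U (pb_proj p) ->
  assoc_triv phi (cls p a) = (pb_proj p, rho (phi p).2 a).
Proof.
move=> Up; rewrite /assoc_triv assoc_proj_class; congr pair.
have /esym/assoc_class_eqP[g [-> ->]] := assoc_class_repr (cls p a).
by rewrite phiM // -repM -mulgA mulgV mulg1.
Qed.

Lemma assoc_triv_fib x (u : fib L x) : U x ->
  (assoc_triv phi (fib_val u)).2 = rho (phi (base_point x)).2 (fib_coord u).
Proof.
by move=> Ux; rewrite /fib_val -fibre_coordE assoc_trivE ?base_pointP.
Qed.

End Trivialisation.

Section Smoothness.
Variable S : atlas R (assoc_total P rho).
Local Notation E := (AtlasSpace S).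
Hypothesis hE : is_frechet_manifold E.
Hypothesis sq : submersion (M := assoc_pair P A) (N := E) quo.

Let hM : is_frechet_manifold M := fmP M.
Let hP : is_frechet_manifold P := fmP P.
Let hG : is_frechet_manifold (lg_space G) := lg_manifold G.

Lemma rc_frechet_manifold : is_frechet_manifold (rc_space A).
Proof. exact/is_frechet_manifold_tvs/is_frechet_realify/rc_frechet. Qed.
Let hA := rc_frechet_manifold.
Let hPA : is_frechet_manifold (assoc_pair P A) :=
  is_frechet_manifold_prod hP hA.

Lemma assoc_class_onto (e : E) : exists z, assoc_class rho z = e.
Proof. by exists (assoc_repr e); exact: reprK. Qed.

(** Composed with the quotient map it becomes the smooth map (p, a) -> pi p. *)
Lemma assoc_proj_smooth : smooth (M := E) (N := M) proj.
Proof.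
apply: (submersion_descent hPA hE hM sq assoc_class_onto openT).
apply: (@eq_smooth_on _ (assoc_pair P A) M _ (projP \o fst)) => //.
- exact: openT.
- by move=> [p a] _ /=; rewrite assoc_proj_class.
- apply: (smooth_on_comp (N := P) (D' := setT)) => //; try exact: openT.
    exact: smooth_fst.
  exact: pb_proj_smooth.
Qed.

(** The inverse sends (x, a) to [s x, a], where s x = psi (x, 1) is the point
    over x whose group coordinate is 1. *)
Lemma assoc_triv_diffeo (U : set M) (phi : P -> prod_space M (lg_space G)) :
  open U -> diffeo_on (M := P) phi (projP @^-1` U) (U `*` setT) ->
  (forall p, U (pb_proj p) -> (phi p).1 = pb_proj p) ->
  (forall p g, U (pb_proj p) -> (phi (pb_act p g)).2 = ((phi p).2 * g)%g) ->
  diffeo_on (M := E) (assoc_triv phi) (proj @^-1` U) (U `*` setT).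
Proof.
move=> oU [oPU oUG sphi [psi [spsi phiK psiK]]] phi1 phiM.
have hMG := is_frechet_manifold_prod hM hG.
have hMA := is_frechet_manifold_prod hM hA.
have hGA := is_frechet_manifold_prod hG hA.
have oproj : open (proj @^-1` U).
  by apply: (@open_comp E M) => // x _; exact: (assoc_proj_smooth.1).
have oUA : open (U `*` [set: A]) by exact: openXT.
split => //.
  apply: (submersion_descent hPA hE hMA sq assoc_class_onto oproj).
  have oD : open (quo @^-1` (proj @^-1` U)).
    by apply: (@open_comp (assoc_pair P A) E) => // z _; exact: (sq.1.1).
  apply: (@eq_smooth_on _ (assoc_pair P A) (prod_space M (rc_space A)) _
    (fun z => (pb_proj z.1, rho (phi z.1).2 z.2))) => //.
    move=> [p a] /=; rewrite assoc_proj_class => Up.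
    by rewrite (assoc_trivE phiM).
  have sfst : smooth_on (M := assoc_pair P A) (N := P)
      (quo @^-1` (proj @^-1` U)) fst.
    by apply: smooth_on_subset (smooth_fst hP hA) => z.
  have DU z : (quo @^-1` (proj @^-1` U)) z -> U (pb_proj z.1).
    by case: z => p a /=; rewrite assoc_proj_class.
  apply: smooth_on_pair.
    apply: (smooth_on_comp (N := P) (D' := setT) (g := projP)) => //.
      exact: openT.
    exact: pb_proj_smooth.
  apply: (smooth_on_comp (M := assoc_pair P A)
    (N := prod_space (lg_space G) (rc_space A)) (Q := rc_space A) (D' := setT)
    (f := fun z => ((phi z.1).2, z.2)) (g := fun z => rho z.1 z.2)) => //.
  + exact: openT.
  + apply: smooth_on_pair; last first.
      by apply: smooth_on_subset (smooth_snd hP hA) => z.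
    apply: (smooth_on_comp (N := P) (D' := projP @^-1` U)
      (g := fun p => (phi p).2)) => //.
    apply: (smooth_on_comp (N := prod_space M (lg_space G)) (D' := setT)
      (g := snd)) => //.
      exact: openT.
    exact: smooth_snd.
  + exact: rep_smooth.
exists (fun z => cls (psi (z.1, 1%g)) z.2); split.
- apply: (smooth_on_comp (M := prod_space M (rc_space A)) (N := assoc_pair P A)
    (Q := E) (D' := setT)
    (f := fun z => (psi (z.1, 1%g), z.2)) (g := quo)) => //.
  + exact: openT.
  + apply: smooth_on_pair; last first.
      by apply: smooth_on_subset (smooth_snd hM hA) => z.
    apply: (smooth_on_comp (M := prod_space M (rc_space A))
      (N := prod_space M (lg_space G)) (Q := P) (D' := U `*` setT)
      (f := fun z => (z.1, 1%g)) (g := psi)) => //.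
    apply: smooth_on_pair.
      by apply: smooth_on_subset (smooth_fst hM hA) => z.
    apply: smooth_on_subset (smooth_cst _ _) => //.
  + by case: sq.
- move=> e Ue; have [[p a] ez] := assoc_class_onto e; rewrite -{}ez in Ue *.
  have Up : U (projP p) by rewrite -(assoc_proj_class p a).
  rewrite (assoc_trivE phiM) //=; split => //.
  have [Upsi phipsi] := psiK (pb_proj p, 1%g) (conj Up I).
  have ppsi : pb_proj p = pb_proj (psi (pb_proj p, 1%g)).
    by rewrite -(phi1 _ Upsi) phipsi.
  have [g pg] := act_transitive (esym ppsi).
  rewrite [in RHS]pg assoc_class_act; congr (cls _ (rho _ _)).
  by rewrite pg phiM // phipsi mul1g.
- move=> [x a] [Ux _] /=.
  have [Upsi phipsi] := psiK (x, 1%g) (conj Ux I).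
  have ppsi : pb_proj (psi (x, 1%g)) = x by rewrite -(phi1 _ Upsi) phipsi.
  rewrite /preimage /= assoc_proj_class (assoc_trivE phiM) ?ppsi //.
  by rewrite phipsi rep1.
Qed.

Lemma assoc_vb_trivialisation (U : set M)
    (phi : P -> prod_space M (lg_space G)) :
  open U -> diffeo_on (M := P) phi (projP @^-1` U) (U `*` setT) ->
  (forall p, U (pb_proj p) -> (phi p).1 = pb_proj p) ->
  (forall p g, U (pb_proj p) -> (phi (pb_act p g)).2 = ((phi p).2 * g)%g) ->
  vb_trivialisation (E := E) (F := A) L U (assoc_triv phi).
Proof.
move=> oU dphi phi1 phiM; split => //; first exact: assoc_triv_diffeo.
by move=> x Ux k u v; rewrite !(assoc_triv_fib phiM) // linearP rep_linear.
Qed.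

Lemma assoc_rigged_cstar_bundle :
  is_rigged_cstar_bundle (E := E) (L := L) assoc_norm assoc_mul assoc_star A.
Proof.
split.
- split => //; [exact: rc_frechet | exact: assoc_proj_smooth |].
  move=> x; have [U [phi [oU Ux dphi phi1 phiM]]] := pb_triv P x.
  by exists U, (assoc_triv phi); split => //; exact: assoc_vb_trivialisation.
- exact: assoc_is_norm.
- exact: assoc_is_star_algebra.
move=> x; have [U [phi [oU Ux dphi phi1 phiM]]] := pb_triv P x.
exists U, (assoc_triv phi); split => //; first exact: assoc_vb_trivialisation.
move=> y Uy phi_y.
have phi_yE u : phi_y u = rho (phi (base_point y)).2 (fib_coord u).
  exact: (assoc_triv_fib phiM u Uy).
have rg := rep_morphism rho (phi (base_point y)).2.
split=> [u v|u|u]; rewrite !phi_yE.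
- by rewrite fib_coord_mul (rigged_morphism_mul rg).
- by rewrite fib_coord_star (rigged_morphism_star rg).
- by rewrite rep_isometric assoc_normE_coord.
Qed.

End Smoothness.
End AssociatedFibres.

Theorem proposition2p2p8 (R : realType) (G : frechetLieGroup R)
    (M : frechetManifold R) (P : principalBundle G M) (A : riggedCstar R)
    (rho : smoothRep G A) (S : atlas R (assoc_total P rho)) :
  is_frechet_manifold (AtlasSpace S) ->
  submersion (M := assoc_pair P A) (N := AtlasSpace S) (assoc_class rho) ->
  exists (L : fibre_lmod R (assoc_proj rho))
         (N : assoc_total P rho -> R)
         (mul : forall x, fib L x -> fib L x -> fib L x)
         (star : forall x, fib L x -> fib L x),
    let elt p a : fib L (pb_proj p) := assoc_elt rho p a in
    [/\ forall p, linear (elt p),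
        forall p a, N (assoc_class rho (p, a)) = rc_norm a,
        forall p a1 a2,
          mul (pb_proj p) (elt p a1) (elt p a2) = elt p (rc_mul a1 a2) &
        forall p a, star (pb_proj p) (elt p a) = elt p (rc_star a)] /\
    is_rigged_cstar_bundle (E := AtlasSpace S) (M := M) N mul star A.
Proof.
move=> hE sq.
exists (assoc_lmod P rho), (@assoc_norm R G M P A rho),
  (@assoc_mul R G M P A rho), (@assoc_star R G M P A rho).
split; last exact: assoc_rigged_cstar_bundle.
split=> [p|p a|p a b|p a].
- exact: assoc_elt_linear.
- exact: assoc_normE.
- exact: assoc_elt_mul.
- exact: assoc_elt_star.
Qed.
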